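(* Let $0\le q<r\le m$ and $k\in\mathbb{Z}_{\ge0}$, and consider $QRM_m(q,r)$. For every $K\in\mathcal{Q}_k$, the operator $\widetilde{Z}(k)_{\langle K\rangle}$ implements the logical multi-controlled-$Z$ circuit corresponding to the collection of minimal covers of $K$: $$\widetilde{Z}(k)_{\langle K\rangle}\equiv\overline{C^{\mathcal{F}(K)}Z}.$$
   Context: Subcubes. $S=\{e_1,\dots,e_m\}$ is the standard basis of $\mathbb{Z}_2^m$ (identified with $[m]$). For $J\subseteq S$, $\langle J\rangle$ is the subgroup generated by $J$ and $e_J=\sum_{i\in J}e_i$. A subcube of type $J$ is a coset $x+\langle J\rangle$, of dimension $|J|$. $|x|$ is Hamming weight. Code. $2^m$ physical qubits are indexed by $\mathbb{Z}_2^m$; $U_A$ acts as the single-qubit gate $U$ on qubits in $A$ and identity elsewhere. $QRM_m(q,r)$ is the common $+1$ eigenspace of all $X_A$ with $A$ an $(m-q)$-dimensional subcube and all $Z_A$ with $A$ an $(r+1)$-dimensional subcube. Operators. $Z(k)=\mathrm{diag}(1,e^{i\pi/2^k})$; $\widetilde{Z}(k)_A$ acts on qubit $x$ as $Z(k)$ if $x\in A$, $|x|$ even; as $Z(k)^\dagger$ if $x\in A$, $|x|$ odd; identity if $x\notin A$. Logical qubits. They are indexed by $\mathcal{Q}=\{J\subseteq S: q+1\le|J|\le r\}$, with logical Paulis $\overline{Z}_J=Z_{\langle J\rangle}$, $\overline{X}_J=X_{e_J+\langle S\setminus J\rangle}$ (these form a symplectic basis). Logical computational basis: $|\overline{0}\rangle$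 is the unit code state (unique up to phase) fixed by all $\overline{Z}_J$, and $|\overline{a}\rangle=\prod_J\overline{X}_J^{a_J}|\overline 0\rangle$ for $a\in\{0,1\}^{\mathcal{Q}}$. For nonempty $\mathcal{J}\subseteq\mathcal{Q}$, $\overline{C^{\mathcal{J}}Z}$ maps $|\overline a\rangle$ to $-|\overline a\rangle$ if $a_J=1$ for all $J\in\mathcal{J}$, and fixes $|\overline a\rangle$ otherwise; $\overline{C^{\emptyset}Z}$ is the identity. For a collection $\mathcal{F}$ of subsets of $\mathcal{Q}$, $\overline{C^{\mathcal{F}}Z}=\prod_{\mathcal{J}\in\mathcal{F}}\overline{C^{\mathcal{J}}Z}$. Index sets and covers. $\mathcal{Q}_k=\{K\subseteq S: q+kr+1\le|K|\le(k+1)r\}$. For $K\in\mathcal{Q}_k$, a minimal cover for $K$ is a subset $\mathcal{J}\subseteq\mathcal{Q}$ with $\bigcup_{J\in\mathcal{J}}J=K$ and $|\mathcal{J}|=k+1$; $\mathcal{F}(K)$ is the set of all minimal covers for $K$. Logical equivalence. $U\equiv V$ means that for some real $\theta$, $U|\psi\rangle=e^{i\theta}V|\psi\rangle$ for every code state $|\psi\rangle$. *)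

(* Defs.v *)
From HB Require Import structures.
From mathcomp Require Import all_boot all_order all_fingroup all_algebra.
From mathcomp Require Import complex reals trigo.

Set Implicit Arguments.
Unset Strict Implicit.
Unset Printing Implicit Defensive.

Import Order.TTheory GRing.Theory Num.Theory.

Local Open Scope ring_scope.
Local Open Scope sesquilinear_scope.

Definition expi (R : realType) (t : R) : R[i] := (cos t +i* sin t)%C.

Definition qubit (m : nat) := 'rV['F_2]_m.

Definition hamming_weight (m : nat) (x : qubit m) : nat :=
  #|[set i | x 0 i != 0]|.

Definition unit_vec (m : nat) (i : 'I_m) : qubit m := delta_mx 0 i.

(* A set J of standard basis vectors is represented by its set of indices. *)
Definition indicator_vec (m : nat) (J : {set 'I_m}) : qubit m :=
  \sum_(i in J) unit_vec i.

(* The finite group structure on a finite zmodType is the additive one. *)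
Definition std_subgroup (m : nat) (J : {set 'I_m}) : {set qubit m} :=
  <<[set unit_vec i | i in J]>>%g.

Definition subcube (m : nat) (x : qubit m) (J : {set 'I_m}) : {set qubit m} :=
  [set x + y | y in std_subgroup J].

Definition is_subcube (m d : nat) (A : {set qubit m}) : Prop :=
  exists x J, A = subcube x J /\ #|J| = d.

(* A pure state of the 2 ^ m qubits is given by its amplitudes on the
   computational basis, i.e. on the assignments of a bit to every qubit. *)
Definition bits (m : nat) := {ffun qubit m -> 'I_2}.

Definition state (R : realType) (m : nat) := {ffun bits m -> R[i]^o}.

Definition inner (R : realType) (m : nat) (u v : state R m) : R[i] :=
  \sum_b (u b)^* * v b.

Definition gate (R : realType) := 'M[R[i]]_2.

Definition gateX (R : realType) : gate R := \matrix_(i, j) (i != j)%:R.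

Definition diag_gate (R : realType) (a b : R[i]) : gate R :=
  diag_mx (\row_(i < 2) if i == 0 then a else b).

Definition gateZ (R : realType) : gate R := diag_gate 1 (- 1).

Definition gateZk (R : realType) (k : nat) : gate R :=
  diag_gate 1 (expi (pi / 2 ^+ k)).

(* The tensor product over all qubits x of the single-qubit gates G x. *)
Definition tensor_op (R : realType) (m : nat) (G : qubit m -> gate R)
    (psi : state R m) : state R m :=
  [ffun b : bits m => \sum_(c : bits m) (\prod_x G x (b x) (c x)) * psi c].

Definition on_qubits (R : realType) (m : nat) (U : gate R)
    (A : {set qubit m}) : state R m -> state R m :=
  tensor_op (fun x => if x \in A then U else 1%:M).

Definition Zk_alternating (R : realType) (m k : nat) (A : {set qubit m}) :
    state R m -> state R m :=
  tensor_op (fun x =>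
    if x \in A then
      if odd (hamming_weight x) then (gateZk R k)^t* else gateZk R k
    else 1%:M).

Definition in_QRM (R : realType) (m q r : nat) (psi : state R m) : Prop :=
  (forall A, is_subcube (m - q) A -> on_qubits (gateX R) A psi = psi) /\
  (forall A, is_subcube r.+1 A -> on_qubits (gateZ R) A psi = psi).

Definition logical_qubit (m q r : nat) :=
  {J : {set 'I_m} | (q.+1 <= #|J| <= r)%N}.

Definition logicalZ (R : realType) (m q r : nat) (J : logical_qubit m q r) :
    state R m -> state R m :=
  on_qubits (gateZ R) (std_subgroup (val J)).

Definition logicalX (R : realType) (m q r : nat) (J : logical_qubit m q r) :
    state R m -> state R m :=
  on_qubits (gateX R) (subcube (indicator_vec (val J)) (~: val J)).

Definition is_logical_zero (R : realType) (m q r : nat) (v : state R m) : Prop :=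
  [/\ in_QRM q r v, inner v v = 1 &
      forall J : logical_qubit m q r, logicalZ J v = v].

Definition comp_op (T : Type) (f g : T -> T) : T -> T := f \o g.

Definition logical_basis (R : realType) (m q r : nat) (v0 : state R m)
    (a : {ffun logical_qubit m q r -> bool}) : state R m :=
  (\big[@comp_op _/id]_J (if a J then @logicalX R m q r J else id)) v0.

(* With v0 the logical zero state, the states [logical_basis v0 a] form an
   orthonormal basis of the code.  This reflection negates those with
   a J = 1 for all J in JJ and fixes the others (see [logical_CZ_basis]);
   for JJ = set0 it is the identity by convention. *)
Definition logical_CZ (R : realType) (m q r : nat) (v0 : state R m)
    (JJ : {set logical_qubit m q r}) (psi : state R m) : state R m :=
  psi - 2 *: \sum_(a : {ffun logical_qubit m q r -> bool}
                    | (JJ != set0) && [forall J in JJ, a J])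
               inner (logical_basis v0 a) psi *: logical_basis v0 a.

Definition logical_CZs (R : realType) (m q r : nat) (v0 : state R m)
    (F : {set {set logical_qubit m q r}}) : state R m -> state R m :=
  \big[@comp_op _/id]_(JJ in F) logical_CZ v0 JJ.

Definition cover_index (m q r k : nat) : {set {set 'I_m}} :=
  [set K : {set 'I_m} | (q + k * r + 1 <= #|K| <= k.+1 * r)%N].

Definition min_covers (m q r k : nat) (K : {set 'I_m}) :
    {set {set logical_qubit m q r}} :=
  [set JJ : {set logical_qubit m q r} |
    (\bigcup_(J in JJ) val J == K) && (#|JJ| == k.+1)].

Definition logically_equiv (R : realType) (m q r : nat)
    (U V : state R m -> state R m) : Prop :=
  exists theta : R, forall psi, in_QRM q r psi ->
    U psi = expi theta *: V psi.

Definition flip (m : nat) (A : {set qubit m}) (b : bits m) : bits m :=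
  [ffun x => if x \in A then rev_ord (b x) else b x].

Lemma flipK (m : nat) (A : {set qubit m}) : involutive (flip A).
Proof.
by move=> b; apply/ffunP=> x; rewrite !ffunE; case: (x \in A); rewrite ?rev_ordK.
Qed.

Lemma tensor_op1 (R : realType) (m : nat) (G : qubit m -> gate R) (g : qubit m -> R[i])
   (f : bits m -> bits m) (psi : state R m) (b : bits m) :
  (forall x j, G x (b x) j = if j == f b x then g x else 0) ->
  tensor_op G psi b = (\prod_x g x) * psi (f b).
Proof.
move=> H; rewrite ffunE (bigD1 (f b)) //= [X in _ + X]big1 ?addr0.
  by congr (_ * _); apply: eq_bigr => x _; rewrite H eqxx.
move=> c neq; have [x Hx] : exists x, c x != f b x.
  apply/existsP; apply: contraR neq => /existsPn E.
  by apply/eqP/ffunP => x; move: (E x); rewrite negbK => /eqP.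
by rewrite (bigD1 x) //= H (negbTE Hx) !mul0r.
Qed.

Lemma on_qubitsX (R : realType) (m : nat) (A : {set qubit m}) (psi : state R m) b :
  on_qubits (gateX R) A psi b = psi (flip A b).
Proof.
rewrite /on_qubits (@tensor_op1 _ _ _ (fun=> 1) (flip A)) ?big1 ?mul1r //.
move=> x j; rewrite ffunE; case: (x \in A); rewrite !mxE; last first.
  by rewrite eq_sym; case: (_ == _).
by case: (b x) j => [[|[|?]] ?] [[|[|?]] ?].
Qed.

Lemma on_qubitsZ (R : realType) (m : nat) (A : {set qubit m}) (psi : state R m) b :
  on_qubits (gateZ R) A psi b = (\prod_(x in A) (-1) ^+ (b x)) * psi b.
Proof.
rewrite /on_qubits (@tensor_op1 _ _ _ (fun x => if x \in A then (-1) ^+ (b x) else 1) id).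
  by rewrite -big_mkcond.
move=> x j; case: ifP => _; rewrite !mxE [j == _]eq_sym /=.
  by case: (b x == j) => //=; case: (b x) => [[|[|?]] ?].
by case: (b x == j).
Qed.

Lemma on_qubitsZX (R : realType) (m : nat) (A B : {set qubit m}) (psi : state R m) :
  on_qubits (gateZ R) B (on_qubits (gateX R) A psi) =
  (-1) ^+ #|A :&: B| *: on_qubits (gateX R) A (on_qubits (gateZ R) B psi).
Proof.
apply/ffunP => b; rewrite [RHS]ffunE on_qubitsZ !on_qubitsX on_qubitsZ.
rewrite /GRing.scale /= mulrA; congr (_ * _).
rewrite [LHS](bigID (mem A)) [X in _ * X](bigID (mem A)) mulrA /=; congr (_ * _).
  rewrite -sum1_card (eq_bigl (fun x => (x \in B) && (x \in A))); last first.
    by move=> x; rewrite inE andbC.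
  rewrite -prodrXr -big_split /=; apply: eq_bigr => x /andP[_ xA].
  rewrite ffunE xA expr1; case: (b x) => [[|[|?]] ?] //=.
  - by rewrite expr0 expr1 mulrNN mulr1.
  - by rewrite subnn expr0 mulr1.
apply: eq_bigr => x /andP[_ /negbTE xA]; by rewrite ffunE xA.
Qed.

Lemma innerXX (R : realType) (m : nat) (A : {set qubit m}) (u v : state R m) :
  inner (on_qubits (gateX R) A u) (on_qubits (gateX R) A v) = inner u v.
Proof.
rewrite /inner [RHS](reindex_inj (inv_inj (@flipK m A))).
by apply: eq_bigr => b _; rewrite !on_qubitsX.
Qed.

Lemma innerZl (R : realType) (m : nat) (c : R[i]) (u v : state R m) :
  inner (c *: u) v = c^* * inner u v.
Proof.
by rewrite /inner mulr_sumr; apply: eq_bigr => b _; rewrite ffunE rmorphM mulrA.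
Qed.

Lemma innerZr (R : realType) (m : nat) (c : R[i]) (u v : state R m) :
  inner u (c *: v) = c * inner u v.
Proof.
by rewrite /inner mulr_sumr; apply: eq_bigr => b _; rewrite ffunE mulrCA.
Qed.

Lemma innerZZ (R : realType) (m : nat) (A : {set qubit m}) (u v : state R m) :
  inner (on_qubits (gateZ R) A u) (on_qubits (gateZ R) A v) = inner u v.
Proof.
apply: eq_bigr => b _; rewrite !on_qubitsZ rmorphM mulrACA.
have -> : (\prod_(x in A) (-1) ^+ b x)^* * (\prod_(x in A) (-1) ^+ b x) = 1 :> R[i].
  rewrite rmorph_prod -big_split big1 //= => x _.
  by rewrite rmorphXn rmorphN1 -exprD addnn -signr_odd odd_double expr0.
by rewrite mul1r.
Qed.

Lemma in_std_subgroup (m : nat) (J : {set 'I_m}) (x : qubit m) :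
  (x \in std_subgroup J) = [forall i, (i \notin J) ==> (x 0 i == 0)].
Proof.
apply/idP/forallP => [xJ i|H].
  apply/implyP => iJ.
  have gP : group_set [set y : qubit m | y 0 i == 0].
    apply/group_setP; split=> [|y z]; rewrite !inE ?mxE // => /eqP y0 /eqP z0.
    by rewrite y0 z0 addr0.
  suff /subsetP/(_ x xJ) : std_subgroup J \subset [set y : qubit m | y 0 i == 0].
    by rewrite inE.
  rewrite (gen_subG _ (Group gP)) /=.
  apply/subsetP => y /imsetP[j jJ ->]; rewrite inE mxE /=.
  by case: (eqVneq i j) => // eij; rewrite eij jJ in iJ.
rewrite [x]row_sum_delta.
elim/big_ind: _ => [|y z Hy Hz|i _]; [exact: group1|exact: groupM|].
have [iJ|iJ] := boolP (i \in J); last first.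
  by move: (H i); rewrite iJ => /eqP ->; rewrite scale0r; exact: group1.
have [->|->] : x 0 i = 0 \/ x 0 i = 1.
  by case: (x 0 i) => [[|[|?]] ?] //; [left|right]; apply/val_inj.
  by rewrite scale0r; exact: group1.
by rewrite scale1r mem_gen //; apply/imsetP; exists i.
Qed.

Lemma F2E (c : 'F_2) : c = (c != 0)%:R.
Proof. by case: c => [[|[|?]] ?] //; apply/val_inj. Qed.

Lemma indicator_vecE (m : nat) (J : {set 'I_m}) i :
  indicator_vec J 0 i = (i \in J)%:R.
Proof.
rewrite summxE; case: (boolP (i \in J)) => iJ.
  rewrite (bigD1 i) //= big1 ?addr0 ?mxE ?eqxx // => j /andP[_ ji].
  by rewrite mxE eq_sym (negbTE ji) andbF.
rewrite big1 // => j jJ; rewrite mxE; case: (eqVneq i j) => [ij|_]; last by rewrite andbF.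
by rewrite ij jJ in iJ.
Qed.

Lemma in_logicalX_subcube (m : nat) (J : {set 'I_m}) (x : qubit m) :
  (x \in subcube (indicator_vec J) (~: J)) = [forall i in J, x 0 i != 0].
Proof.
apply/imsetP/forall_inP => [[y Hy ->] i iJ|H].
  move: Hy; rewrite in_std_subgroup => /forallP/(_ i); rewrite inE negbK iJ /=.
  by move=> /eqP y0; rewrite mxE y0 addr0 indicator_vecE iJ oner_eq0.
exists (x - indicator_vec J); last by rewrite addrC subrK.
rewrite in_std_subgroup; apply/forallP => i; rewrite inE negbK; apply/implyP => iJ.
by rewrite !mxE indicator_vecE iJ [x 0 i]F2E H // subrr.
Qed.

Lemma odd_logical_overlap (m : nat) (J J' : {set 'I_m}) :
  odd #|subcube (indicator_vec J') (~: J') :&: std_subgroup J| = (J == J').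
Proof.
set S := _ :&: _.
have SE x : (x \in S) = [forall i in J', x 0 i != 0] &&
    [forall i, (i \notin J) ==> (x 0 i == 0)].
  by rewrite inE in_logicalX_subcube in_std_subgroup.
case: (eqVneq J J') => [eqJ|neqJ].
  suff -> : S = [set indicator_vec J] by rewrite cards1.
  apply/setP => x; rewrite SE inE -eqJ; apply/andP/eqP => [[/forall_inP H1 /forallP H2]|->].
    apply/rowP => i; rewrite indicator_vecE [LHS]F2E; congr (nat_of_bool _)%:R.
    by move: (H1 i) (H2 i); case: (i \in J) => /= [->|_ ->].
  split; [apply/forall_inP => i iJ | apply/forallP => i; apply/implyP => /negbTE iJ];
    by rewrite indicator_vecE iJ ?oner_eq0.
have [sJ|] := boolP (J' \subset J); last first.
  case/subsetPn => i iJ' iJ; suff -> : S = set0 by rewrite cards0.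
  apply/setP => x; rewrite SE inE; apply/negbTE/negP => /andP[/forall_inP/(_ _ iJ') H1].
  by move=> /forallP/(_ i); rewrite iJ /= (negbTE H1).
have /subsetPn[i iJ iJ'] : ~~ (J \subset J').
  by apply: contra neqJ => sJ'; rewrite eqEsubset sJ' sJ.
pose f (x : qubit m) : qubit m := x + unit_vec i.
have fK : involutive f.
  move=> x; rewrite /f -addrA -[RHS]addr0; congr (_ + _).
  by apply/rowP => j; rewrite !mxE; case: (_ && _); apply/val_inj.
have fS x : (f x \in S) = (x \in S).
  have imp y : y \in S -> f y \in S.
    rewrite !SE => /andP[/forall_inP H1 /forallP H2]; apply/andP; split.
      apply/forall_inP => j jJ'; rewrite !mxE /=.
      case: (eqVneq j i) => [ji|_]; last by rewrite ?andbF addr0 H1.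
      by rewrite ji (negbTE iJ') in jJ'.
    apply/forallP => j; apply/implyP => jJ; rewrite !mxE /=.
    case: (eqVneq j i) => [ji|_]; last by rewrite ?andbF addr0; apply: implyP (H2 j) jJ.
    by rewrite ji iJ in jJ.
  by apply/idP/idP => [/imp|/imp//]; rewrite fK.
pose S1 := S :&: [set x : qubit m | x 0 i == 0].
rewrite -(cardsID [set x : qubit m | x 0 i == 0] S).
suff -> : S :\: [set x : qubit m | x 0 i == 0] = f @: S1.
  by rewrite card_imset ?addnn ?odd_double //; exact: inv_inj.
apply/setP => x; rewrite -[x in RHS]fK mem_imset; last exact: inv_inj.
rewrite in_setD [RHS]in_setI fS andbC; congr (_ && _).
rewrite !inE !mxE !eqxx /=.
by case: (x 0 i) => [[|[|?]] ?].
Qed.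


Lemma on_qubitsX_scale (R : realType) (m : nat) (A : {set qubit m}) c (psi : state R m) :
  on_qubits (gateX R) A (c *: psi) = c *: on_qubits (gateX R) A psi.
Proof. by apply/ffunP => b; rewrite on_qubitsX [LHS]ffunE [RHS]ffunE on_qubitsX. Qed.

Lemma logicalZX (R : realType) (m q r : nat) (J J' : logical_qubit m q r)
   (psi : state R m) :
  logicalZ J (logicalX J' psi) = (-1) ^+ (J == J') *: logicalX J' (logicalZ J psi).
Proof.
by rewrite /logicalZ /logicalX on_qubitsZX -signr_odd odd_logical_overlap.
Qed.

Lemma logicalZ_basis (R : realType) (m q r : nat) (v0 : state R m)
    (hv0 : is_logical_zero q r v0) (a : {ffun logical_qubit m q r -> bool}) J :
  logicalZ J (logical_basis v0 a) = (-1) ^+ (a J) *: logical_basis v0 a.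
Proof.
case: hv0 => _ _ HZ; rewrite /logical_basis.
have -> : (-1) ^+ a J = (-1) ^+ (count_mem J [seq K <- index_enum (logical_qubit m q r) | a K]) :> R[i].
  have -> // : nat_of_bool (a J) = count_mem J [seq K <- index_enum (logical_qubit m q r) | a K].
  rewrite count_uniq_mem ?filter_uniq ?index_enum_uniq // mem_filter mem_index_enum.
  by rewrite andbT.
elim: (index_enum _) => [|K s IH]; first by rewrite big_nil /= expr0 scale1r HZ.
rewrite big_cons /comp_op /=; case: (a K) => //=.
rewrite logicalZX IH /logicalX on_qubitsX_scale scalerA -exprD.
by rewrite eq_sym.
Qed.

Lemma logical_basis_norm (R : realType) (m q r : nat) (v0 : state R m)
    (hv0 : is_logical_zero q r v0) (a : {ffun logical_qubit m q r -> bool}) :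
  inner (logical_basis v0 a) (logical_basis v0 a) = 1.
Proof.
case: hv0 => _ H1 _; rewrite /logical_basis.
elim: (index_enum _) => [|K s IH]; first by rewrite big_nil.
by rewrite big_cons /comp_op /=; case: (a K) => //=; rewrite innerXX.
Qed.

Lemma logical_basis_orthonormal (R : realType) (m q r : nat) (v0 : state R m)
    (hv0 : is_logical_zero q r v0) (a b : {ffun logical_qubit m q r -> bool}) :
  inner (logical_basis v0 a) (logical_basis v0 b) = (a == b)%:R.
Proof.
case: (eqVneq a b) => [->|neq]; first exact: logical_basis_norm.
have [J HJ] : exists J, a J != b J.
  apply/existsP; apply: contraR neq => /existsPn E.
  by apply/eqP/ffunP => x; move: (E x); rewrite negbK => /eqP.
apply/eqP; rewrite -eqNr -{2}(innerZZ (std_subgroup (val J))) -!/(logicalZ J _) !logicalZ_basis //.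
rewrite innerZl innerZr mulrA rmorphXn rmorphN1 -signr_addb eq_sym; apply/eqP.
by move: HJ; case: (a J); case: (b J) => //= _; rewrite expr1 mulN1r.
Qed.

Lemma logical_CZ_basis (R : realType) (m q r : nat) (v0 : state R m)
    (hv0 : is_logical_zero q r v0) (JJ : {set logical_qubit m q r})
    (a : {ffun logical_qubit m q r -> bool}) :
  logical_CZ v0 JJ (logical_basis v0 a) =
  if (JJ != set0) && [forall J in JJ, a J] then - logical_basis v0 a
  else logical_basis v0 a.
Proof.
rewrite /logical_CZ.
have E b : inner (logical_basis v0 b) (logical_basis v0 a) *: logical_basis v0 b =
    if b == a then logical_basis v0 a else 0.
  rewrite logical_basis_orthonormal //.
  by case: eqP => [->|_]; rewrite ?scale1r ?scale0r.
rewrite (eq_bigr _ (fun b _ => E b)) -big_mkcondr /=.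
case: ifP => Ha.
  rewrite (big_pred1 a) => [|b]; last by rewrite /=; case: (eqVneq b a) => [->|_]; rewrite ?Ha ?andbF.
  by rewrite scaler_nat mulr2n opprD addrA subrr add0r.
rewrite big_pred0 ?scaler0 ?subr0 // => b.
by case: (eqVneq b a) => [->|_]; rewrite ?Ha ?andbF.
Qed.

(* Main.v *)
(* View a bit string b on the qubits as a multilinear polynomial over F_2.
   The Z stabilizers force the amplitude of a code state at b to vanish unless
   b has degree at most r; the X stabilizers make it invariant under adding a
   monomial of degree at most q.  So the amplitude at b depends only on the
   coefficients c_J of b with q < |J| <= r, and the logical basis state a lives
   on the b with c_J = a_J: the logical basis spans the code.

   The phase of the transversal operator at b is exp(i pi s / 2^k), where s is
   the sum of (-1)^|x| b(x) over x in <K>.  Expanding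
   1 - 2 b(x) = prod_J (1 - 2 c_J x^J) over families JJ of monomials and summing
   over x with signs kills every JJ whose union is not K, so that, up to sign,
   2 s is the sum of (-2)^|JJ| over the families of monomials of b with union
   K.  As |K| > k r, such a JJ has at least k + 1 members, hence s = 2^k z
   where z has the parity of the number of covers with exactly k + 1 members,
   and the phase is (-1)^z. *)
Require Import Defs.
From mathcomp Require Import all_boot all_order all_algebra.
From mathcomp Require Import complex reals trigo.
From mathcomp Require Import ring zify.

Set Implicit Arguments.
Unset Strict Implicit.
Unset Printing Implicit Defensive.

Import Order.TTheory GRing.Theory Num.Theory.

Section ReedMullerPhases.
Local Open Scope ring_scope.

(** * Bit strings as multilinear polynomials over the two-element field *)

Definition supp (m : nat) (x : qubit m) : {set 'I_m} := [set i | x 0 i != 0].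

(** The points at which the monomial of [J] takes the value 1: flipping them adds that monomial to a
    bit string. This is also the set on which [logicalX] acts. *)
Definition monomial_set (m : nat) (J : {set 'I_m}) : {set qubit m} :=
  subcube (indicator_vec J) (~: J).

(* By Moebius inversion, this is the coefficient of the monomial of J in the
   multilinear polynomial over F_2 that represents b. *)
Definition coef (m : nat) (b : bits m) (J : {set 'I_m}) : bool :=
  odd (\sum_(x in std_subgroup J) b x).

Definition flips (m : nat) (s : seq {set 'I_m}) (b : bits m) : bits m :=
  foldl (fun c J => flip (monomial_set J) c) b s.

Lemma suppK (m : nat) : cancel (@supp m) (@indicator_vec m).
Proof. by move=> x; apply/rowP => i; rewrite indicator_vecE inE -F2E. Qed.

Lemma indicator_vecK (m : nat) : cancel (@indicator_vec m) (@supp m).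
Proof.
by move=> J; apply/setP => i; rewrite inE indicator_vecE; case: (i \in J).
Qed.

Lemma mem_std_subgroup (m : nat) (J : {set 'I_m}) (x : qubit m) :
  (x \in std_subgroup J) = (supp x \subset J).
Proof.
rewrite in_std_subgroup; apply/forallP/subsetP => H i; last first.
  by apply/implyP; apply: contraR => xi; apply: H; rewrite inE.
by rewrite inE => xi; move: (H i); rewrite (negbTE xi) implybF negbK.
Qed.

Lemma mem_monomial_set (m : nat) (J : {set 'I_m}) (x : qubit m) :
  (x \in monomial_set J) = (J \subset supp x).
Proof.
rewrite in_logicalX_subcube; apply/forall_inP/subsetP => H i iJ.
  by rewrite inE H.
by move: (H i iJ); rewrite inE.
Qed.

Lemma odd_sum (I : finType) (P : pred I) (F : I -> nat) :
  odd (\sum_(i | P i) F i) = \big[addb/false]_(i | P i) odd (F i).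
Proof. exact: (big_morph odd oddD). Qed.

Lemma odd_flip (m : nat) (A : {set qubit m}) (b : bits m) x :
  odd (flip A b x) = odd (b x) (+) (x \in A).
Proof.
by rewrite ffunE; case: ifP => _; rewrite ?addbF //; case: (b x) => [[|[|?]] ?].
Qed.

Lemma odd_bits_inj (b c : 'I_2) : odd b = odd c -> b = c.
Proof. by case: b c => [[|[|?]] ?] [[|[|?]] ?] // _; apply/val_inj. Qed.

(** The parity in [odd_logical_overlap] says that the monomial of [J'] has the single coefficient
    [J']; the rest is additivity modulo 2. *)
Lemma coef_flip (m : nat) (b : bits m) (J J' : {set 'I_m}) :
  coef (flip (monomial_set J') b) J = coef b J (+) (J == J').
Proof.
rewrite /coef -odd_logical_overlap -sum1_card !odd_sum big_mkcond /=.
rewrite [X in _ = X (+) _]big_mkcond [X in _ = _ (+) X]big_mkcond -big_split /=.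
apply: eq_bigr => x _; rewrite odd_flip in_setI /monomial_set.
by case: (x \in std_subgroup J); case: (x \in subcube _ _).
Qed.

Lemma coef_flips (m : nat) (s : seq {set 'I_m}) (b : bits m) J :
  coef (flips s b) J = coef b J (+) odd (count_mem J s).
Proof.
elim: s b => [|J' s IH] b /=; first by rewrite addbF.
by rewrite IH coef_flip oddD eq_sym addbA; case: (J' == J).
Qed.

Lemma odd_flips (m : nat) (s : seq {set 'I_m}) (b : bits m) x :
  odd (flips s b x) = odd (b x) (+) odd (count (fun J : {set _} => J \subset supp x) s).
Proof.
elim: s b => [|J s IH] b /=; first by rewrite addbF.
by rewrite IH odd_flip mem_monomial_set oddD addbA; case: (J \subset _).
Qed.

(** Strong induction on the support of [x]: the coefficient at [supp x] sums the bits at points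
    supported in [supp x], and all of these except [x] itself have strictly smaller support. *)
Lemma coef_inj (m : nat) (b c : bits m) : coef b =1 coef c -> b = c.
Proof.
move=> E; apply/ffunP => x; have [n] := ubnP #|supp x|.
elim: n x => // n IH x xn; apply: odd_bits_inj.
move: (E (supp x)); rewrite /coef !odd_sum.
rewrite (bigD1 x) ?mem_std_subgroup //= [RHS](bigD1 x) ?mem_std_subgroup //=.
rewrite [X in _ (+) X = _](eq_bigr (fun y => odd (c y))); first exact: addIb.
move=> y; rewrite mem_std_subgroup => /andP[yx nyx]; rewrite IH //.
rewrite -ltnS; apply: leq_trans xn; rewrite ltnS; apply: proper_card.
rewrite properEneq yx andbT; apply: contra nyx => /eqP e.
by rewrite -(suppK y) e suppK.
Qed.

Lemma flips_diff (m : nat) (b c : bits m) :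
  flips (enum [pred J | coef b J != coef c J]) b = c.
Proof.
apply: coef_inj => J; rewrite coef_flips count_uniq_mem ?enum_uniq //.
by rewrite mem_enum inE; case: (coef b J); case: (coef c J).
Qed.

Lemma coef0 (m : nat) J : coef ([ffun=> ord0] : bits m) J = false.
Proof. by rewrite /coef big1 // => x _; rewrite ffunE. Qed.

(** Evaluation of the polynomial at [x]: after building [b] from the zero string by flips, each
    monomial of [b] whose variables lie in [supp x] contributes 1. *)
Lemma odd_bits_coef (m : nat) (b : bits m) x :
  odd (b x) = odd #|[set J | coef b J & J \subset supp x]|.
Proof.
rewrite -[b in LHS](flips_diff [ffun=> ord0] b) odd_flips ffunE /=.
congr (odd _); rewrite cardE -size_filter /enum_mem -filter_predI.
congr (size _); apply: eq_filter => J.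
by rewrite !inE coef0 /= andbC; case: (coef b J).
Qed.

(** * Subcubes and the constraints imposed by stabilizers *)

Lemma mem_subcube (m : nat) (x y : qubit m) (J : {set 'I_m}) :
  (y \in subcube x J) = [forall i, (i \notin J) ==> (y 0 i == x 0 i)].
Proof.
apply/imsetP/forallP => [[z Hz ->] i|H].
  move: Hz; rewrite in_std_subgroup => /forallP/(_ i).
  by case: (i \in J) => //= /eqP z0; rewrite mxE z0 addr0.
exists (y - x); last by rewrite addrC subrK.
rewrite in_std_subgroup; apply/forallP => i; rewrite !mxE subr_eq0; exact: H.
Qed.

(** Splitting along a direction in [J] cuts a cube into two disjoint parallel cubes of one dimension
    less. This carries the stabilizer conditions, given in one dimension only, to all larger
    subcubes. *)
Lemma subcube_ind (m d : nat) (P : {set qubit m} -> Prop) :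
  (forall A, is_subcube d A -> P A) ->
  (forall A B : {set qubit m}, [disjoint A & B] -> P A -> P B -> P (A :|: B)) ->
  forall e A, (d <= e)%N -> is_subcube e A -> P A.
Proof.
move=> Pd PU; elim=> [|e IH] A; first by rewrite leqn0 => /eqP <-; apply: Pd.
rewrite leq_eqVlt => /predU1P[<-|de]; first exact: Pd.
case=> x [J [-> cJ]].
have [i iJ] : exists i, i \in J by apply/set0Pn; rewrite -card_gt0 cJ.
have cJ' : #|J :\ i| = e by move: cJ; rewrite (cardsD1 i) iJ => -[].
have -> : subcube x J = subcube x (J :\ i) :|: subcube (x + unit_vec i) (J :\ i).
  apply/setP => y; rewrite in_setU !mem_subcube.
  apply/forallP/orP => [H|[] /forallP H j]; last 2 first.
  - by move: (H j); rewrite in_setD1; case: (j \in J); rewrite ?andbF ?implybT.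
  - apply/implyP => jJ; move: (H j); rewrite in_setD1 (negbTE jJ) andbF !mxE.
    case: (eqVneq j i) => [ji|_]; first by rewrite -ji (negbTE jJ) in iJ.
    by rewrite andbF addr0.
  have [xy|xy] := eqVneq (y 0 i) (x 0 i); [left|right]; apply/forallP => j;
    rewrite in_setD1 negb_and negbK; apply/implyP.
    by case: (eqVneq j i) => [->|_] //=; [rewrite xy|apply/implyP/H].
  case: (eqVneq j i) => [->|ji] /=; last first.
    by rewrite !mxE (negbTE ji) andbF addr0; apply/implyP/H.
  rewrite !mxE !eqxx => _; move: xy.
  by case: (y 0 i) (x 0 i) => [[|[|?]] ?] [[|[|?]] ?].
apply: PU; [|by apply: IH => //; exists x, (J :\ i)
            |by apply: IH => //; exists (x + unit_vec i), (J :\ i)].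
rewrite -setI_eq0; apply/eqP/setP => y; rewrite in_setI !mem_subcube in_set0.
apply/negbTE/negP => /andP[/forallP/(_ i) H1 /forallP/(_ i)].
move: H1; rewrite in_setD1 eqxx /= => /eqP ->; rewrite !mxE !eqxx /=.
by rewrite -subr_eq0 opprD addrA subrr.
Qed.

Lemma flipU (m : nat) (A B : {set qubit m}) b : [disjoint A & B] ->
  flip (A :|: B) b = flip A (flip B b).
Proof.
move=> dAB; apply/ffunP => x; rewrite !ffunE in_setU.
by case: (boolP (x \in A)) => //= xA; rewrite (disjointFr dAB xA).
Qed.

Lemma sign_prod (R : realType) (I : finType) (P : pred I) (F : I -> nat) :
  \prod_(i | P i) (-1) ^+ F i = (-1) ^+ odd (\sum_(i | P i) F i) :> R[i].
Proof. by rewrite prodrXr signr_odd. Qed.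

Lemma on_qubitsZ_fixed (R : realType) (m : nat) A (psi : state R m) b :
  on_qubits (gateZ R) A psi = psi -> psi b != 0 ->
  odd (\sum_(x in A) b x) = false.
Proof.
move=> /ffunP/(_ b); rewrite on_qubitsZ sign_prod.
case: odd => //; rewrite expr1 mulN1r => /eqP.
by rewrite eqNr => ->.
Qed.

(** * Amplitudes of code states and expansion in the logical basis *)

Section Code.
Variables (R : realType) (m q r : nat).
Local Notation assignment := {ffun logical_qubit m q r -> bool}.

Lemma code_coef_gt (psi : state R m) b (J : {set 'I_m}) : in_QRM q r psi -> psi b != 0 ->
  (r < #|J|)%N -> coef b J = false.
Proof.
move=> [_ HZ] nz rJ; rewrite /coef.
have -> : std_subgroup J = subcube 0 J.
  apply/setP => x; rewrite mem_subcube in_std_subgroup.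
  by apply: eq_forallb => i; rewrite mxE.
apply: (@subcube_ind m r.+1 (fun A => odd (\sum_(x in A) b x) = false))
  rJ _; last by exists 0, J.
- by move=> A /HZ /on_qubitsZ_fixed; apply.
- by move=> A B dAB PA PB; rewrite (eq_bigl [predU A & B]) => [|x];
    rewrite ?inE // bigU //= oddD PA PB.
Qed.

(** The set of the monomial of [J] is a cube of dimension [m - #|J|], at least [m - q], hence a
    disjoint union of supports of X stabilizers. *)
Lemma code_flip (psi : state R m) b (J : {set 'I_m}) : in_QRM q r psi ->
  (#|J| <= q)%N -> psi (flip (monomial_set J) b) = psi b.
Proof.
move=> [HX _] Jq; move: b.
apply: (@subcube_ind m (m - q) (fun A => forall b, psi (flip A b) = psi b)
  _ _ #|~: J|); last by exists (indicator_vec J), (~: J).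
- by move=> A /HX {2}<- b; rewrite on_qubitsX.
- by move=> A B dAB PA PB b; rewrite flipU // PA PB.
- by rewrite cardsCs setCK card_ord leq_sub2l.
Qed.

Lemma code_eq (psi : state R m) b c : in_QRM q r psi ->
  (forall J : {set 'I_m}, (q < #|J|)%N -> coef b J = coef c J) ->
  psi b = psi c.
Proof.
move=> Hpsi E; rewrite -(flips_diff b c).
have : all (fun J : {set 'I_m} => #|J| <= q)%N
    (enum [pred J | coef b J != coef c J]).
  by apply/allP => J; rewrite mem_enum inE leqNgt; apply: contra => /E ->.
move: (enum [pred J | coef b J != coef c J]) => s.
clear E; elim: s b => //= J s IH d /andP[Jq sq].
by rewrite -IH // code_flip.
Qed.

Variables (v0 : state R m) (hv0 : is_logical_zero q r v0).

(** For degrees up to [r] the coefficient is the parity measured by a logical Z, which fixes [v0];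
    above [r] the Z stabilizers take over. *)
Lemma logical_zero_coef b (J : {set 'I_m}) : v0 b != 0 -> (q < #|J|)%N -> coef b J = false.
Proof.
move=> nz qJ; case: hv0 => Hc _ HZ.
have [Jr|rJ] := leqP #|J| r; last exact: code_coef_gt Hc nz rJ.
have qJr : (q < #|J| <= r)%N by rewrite qJ.
exact: on_qubitsZ_fixed (HZ (exist _ J qJr)) nz.
Qed.

(** Wherever [v0] is nonzero, only coefficients of degree at most [q] survive, so the amplitude
    there equals the one at the zero string. If the latter vanished, [v0] would be zero, against its
    unit norm. *)
Lemma logical_zero_neq0 : v0 [ffun=> ord0] != 0.
Proof.
case: hv0 => Hc H1 _; apply/eqP => z; have : inner v0 v0 != 0 by rewrite H1 oner_eq0.
apply/negP; rewrite negbK; apply/eqP/big1 => b _.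
have [->|nz] := eqVneq (v0 b) 0; first by rewrite mulr0.
rewrite (@code_eq v0 b [ffun=> ord0]) ?z ?mulr0 // => J qJ.
by rewrite coef0 logical_zero_coef.
Qed.

(** Kept as a sequence in the order of [index_enum], so that [flips] unfolds in step with the
    product defining [logical_basis]. *)
Definition logical_seq (a : assignment) :=
  [seq val J | J <- index_enum (logical_qubit m q r) & a J].

Lemma count_logical_seq a (J : logical_qubit m q r) :
  count_mem (val J) (logical_seq a) = a J.
Proof.
rewrite count_uniq_mem; last first.
  rewrite map_inj_uniq ?filter_uniq ?index_enum_uniq //; exact: val_inj.
by rewrite mem_map ?mem_filter ?mem_index_enum ?andbT //; exact: val_inj.
Qed.

Lemma count_logical_seq0 a (J : {set 'I_m}) :
  ~~ (q < #|J| <= r)%N -> count_mem J (logical_seq a) = 0%N.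
Proof.
move=> nJ; apply/count_memPn; apply: contra nJ => /mapP[J' _ ->]; exact: (valP J').
Qed.

Lemma logical_basisE a b :
  logical_basis v0 a b = v0 (flips (logical_seq a) b).
Proof.
rewrite /logical_basis /logical_seq.
elim: (index_enum _) b => [|J s IH] b; first by rewrite big_nil.
by rewrite big_cons /comp_op /=; case: (a J) => //=; rewrite on_qubitsX IH.
Qed.

Lemma logical_basis_coef a b (J : logical_qubit m q r) :
  logical_basis v0 a b != 0 -> coef b (val J) = a J.
Proof.
have /andP[qJ _] := valP J.
rewrite logical_basisE => /logical_zero_coef/(_ qJ).
rewrite coef_flips count_logical_seq.
by case: (a J); case: (coef b _).
Qed.

Lemma logical_basis_coef_gt (a : assignment) b (J : {set 'I_m}) :
  logical_basis v0 a b != 0 -> (r < #|J|)%N -> (q < #|J|)%N ->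
  coef b J = false.
Proof.
rewrite logical_basisE => nz rJ qJ; move: (logical_zero_coef nz qJ).
by rewrite coef_flips count_logical_seq0 ?addbF // qJ -ltnNge.
Qed.

(** At the string obtained from zero by adding the monomials of [a], the basis state of [a] has the
    nonzero amplitude of [v0] at the zero string, which explains the quotient. *)
Lemma code_expansion (psi : state R m) : (q < r)%N -> in_QRM q r psi ->
  psi = \sum_(a : assignment) (psi (flips (logical_seq a) [ffun=> ord0]) / v0 [ffun=> ord0])
               *: logical_basis v0 a.
Proof.
move=> qr Hpsi; apply/ffunP => b; rewrite sum_ffunE.
under eq_bigr do rewrite ffunE.
have [/forall_inP Hb|] := boolP [forall (J : {set 'I_m} | (r < #|J|)%N), ~~ coef b J];
    last first.
  case/forall_inPn => J rJ; rewrite negbK => cJ.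
  have -> : psi b = 0.
    by apply/eqP; apply: contraLR cJ => nz; rewrite (code_coef_gt Hpsi nz).
  rewrite big1 // => a _; have [->|nz] := eqVneq (logical_basis v0 a b) 0.
    exact: mulr0.
  by rewrite (logical_basis_coef_gt nz rJ (ltn_trans qr rJ)) in cJ.
(* The coefficients of [b] determine the only assignment whose basis state can be nonzero at [b]. *)
pose a0 := [ffun J : logical_qubit m q r => coef b (val J)].
rewrite (bigD1 a0) //= [X in _ + X]big1 ?addr0; last first.
  move=> a na; have [->|nz] := eqVneq (logical_basis v0 a b) 0; first exact: mulr0.
  case/eqP: na; apply/ffunP => J; rewrite ffunE; exact/esym/logical_basis_coef.
have cE (J : {set 'I_m}) : (q < #|J|)%N -> coef b J = odd (count_mem J (logical_seq a0)).
  move=> qJ; have [Jr|rJ] := leqP #|J| r.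
    have qJr : (q < #|J| <= r)%N by rewrite qJ.
    by rewrite (count_logical_seq a0 (exist _ J qJr)) ffunE; case: coef.
  by rewrite count_logical_seq0 ?qJ -?ltnNge // (negbTE (Hb _ rJ)).
have Hv0 : in_QRM q r v0 by case: hv0.
rewrite logical_basisE (@code_eq v0 (flips _ b) [ffun=> ord0]) //; last first.
  by move=> J qJ; rewrite coef_flips -cE // addbb coef0.
rewrite -[RHS]/(_ * _) divfK ?logical_zero_neq0 //.
by apply: code_eq => // J qJ; rewrite coef_flips coef0 /= cE.
Qed.

Lemma logical_CZ_sum (JJ : {set logical_qubit m q r}) (c : assignment -> R[i]) :
  logical_CZ v0 JJ (\sum_(a : assignment) c a *: logical_basis v0 a) =
  \sum_(a : assignment) ((-1) ^+ ((JJ != set0) && [forall J in JJ, a J]) * c a)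
         *: logical_basis v0 a.
Proof.
have innerS a :
    inner (logical_basis v0 a) (\sum_(a : assignment) c a *: logical_basis v0 a)
    = c a.
  rewrite /inner; under eq_bigr do rewrite sum_ffunE mulr_sumr.
  rewrite exchange_big (bigD1 a) //= [X in _ + X]big1 ?addr0 => [|a' na].
    by rewrite -/(inner _ _) innerZr logical_basis_orthonormal // eqxx mulr1.
  by rewrite -/(inner _ _) innerZr logical_basis_orthonormal // eq_sym (negbTE na) mulr0.
rewrite /logical_CZ scaler_sumr [X in _ - X]big_mkcond -sumrB.
apply: eq_bigr => a _; rewrite innerS; case: ifP => _.
  by rewrite expr1 scalerA -scalerBl; congr (_ *: _); ring.
by rewrite expr0 mul1r subr0.
Qed.

Lemma logical_CZs_sum (F : {set {set logical_qubit m q r}}) (c : assignment -> R[i]) :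
  logical_CZs v0 F (\sum_(a : assignment) c a *: logical_basis v0 a) =
  \sum_(a : assignment) ((-1) ^+ #|[set JJ in F | (JJ != set0) && [forall J in JJ, a J]]| * c a)
         *: logical_basis v0 a.
Proof.
pose p (a : assignment) (JJ : {set logical_qubit m q r}) :=
  (JJ != set0) && [forall J in JJ, a J].
have E a : #|[set JJ in F | p a JJ]| = (\sum_(JJ in F) p a JJ)%N.
  by rewrite -sum1_card big_mkcond [RHS]big_mkcond; apply: eq_bigr => JJ _;
    rewrite inE; case: (JJ \in F); case: (p a JJ).
under [RHS]eq_bigr do rewrite E.
rewrite /logical_CZs; elim: (index_enum _) => [|JJ s IH].
  by rewrite big_nil; apply: eq_bigr => a _; rewrite big_nil mul1r.
rewrite big_cons; under [RHS]eq_bigr do rewrite big_cons.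
case: (JJ \in F); rewrite // /comp_op /= IH logical_CZ_sum.
by apply: eq_bigr => a _; rewrite mulrA exprD.
Qed.

End Code.

(** * Signed sums over subsets and divisibility of the phase sum *)

Lemma sum_subsets_sign (R : numDomainType) (T : finType) (M K : {set T}) :
  \sum_(X : {set T} | (M \subset X) && (X \subset K)) (-1) ^+ #|X| =
  (-1) ^+ #|K| *+ (M == K) :> R.
Proof.
have [->|neq] := eqVneq M K.
  rewrite (big_pred1 K) // => X; rewrite [RHS]/= eqEsubset andbC //.
have [MK|MK] := boolP (M \subset K); last first.
  rewrite big_pred0 // => X; apply: contraNF MK => /andP[]; exact: subset_trans.
have /subsetPn[i iK iM] : ~~ (K \subset M).
  by apply: contra neq => KM; rewrite eqEsubset MK.
(* Toggling an element [i] of [K] outside [M] preserves the range and reverses every sign, so the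
   sum equals its own opposite. *)
pose f (X : {set T}) := if i \in X then X :\ i else i |: X.
have fK : involutive f.
  move=> X; rewrite /f; case: (boolP (i \in X)) => iX.
    by rewrite setD11 setD1K.
  by rewrite setU11 setU1K.
apply/eqP; rewrite mulr0n -eqNr -sumrN; apply/eqP.
rewrite [RHS](reindex_inj (inv_inj fK)); apply: eq_big => X.
  rewrite /f; case: ifP => iX.
    have -> : (X \subset K) = (X :\ i \subset K).
      by rewrite -{1}(setD1K iX) subUset sub1set iK.
    by rewrite subsetD1 iM andbT.
  have -> : (M \subset X) = (M \subset i |: X).
    by rewrite -{1}(setU1K (negbT iX)) subsetD1 iM andbT.
  by rewrite subUset sub1set iK.
move=> _; rewrite /f; case: ifP => iX.
  by rewrite [in LHS](cardsD1 i) iX exprS mulN1r opprK.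
by rewrite cardsU1 iX exprS mulN1r.
Qed.

Lemma expr1D_card (R : comNzRingType) (T : finType) (A : {set T}) (c : R) :
  (1 + c) ^+ #|A| = \sum_(B : {set T} | B \subset A) c ^+ #|B|.
Proof.
rewrite -prodr_const big_mkcond /=.
rewrite (eq_bigr (fun i => (if i \in A then c else 0) + 1)); last first.
  by move=> i _; case: ifP; rewrite ?add0r // addrC.
rewrite bigA_distr [RHS]big_mkcond; apply: eq_bigr => B _.
case: ifP => [/subsetP BA|/negbT/subsetPn[i iB iA]].
  rewrite -prodr_const [RHS]big_mkcond; apply: eq_bigr => i _.
  by case: ifP => // /BA ->.
by rewrite (bigD1 i) //= iB (negbTE iA) mul0r.
Qed.

(** The total rotation angle at [b], in units of [pi / 2 ^+ k]. *)
Definition phase_sum (m : nat) (K : {set 'I_m}) (b : bits m) : int :=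
  \sum_(x in std_subgroup K) (-1) ^+ hamming_weight x * (b x : nat)%:Z.

Lemma sign_bits_coef (R : comNzRingType) (m : nat) (b : bits m) x :
  (-1) ^+ b x = \sum_(JJ : {set {set 'I_m}} | (JJ \subset coef b) && (cover JJ \subset supp x))
     (-2) ^+ #|JJ| :> R.
Proof.
rewrite -signr_odd odd_bits_coef signr_odd.
have -> : -1 = 1 + -2 :> R by ring.
rewrite expr1D_card; apply: eq_bigl => JJ.
apply/subsetP/andP => [H|[/subsetP H1 /bigcupsP H2] J JJJ].
  split; first by apply/subsetP => J /H; rewrite inE => /andP[].
  by apply/bigcupsP => J /H; rewrite inE => /andP[].
by rewrite inE H2 // andbT; exact: H1.
Qed.

Lemma phase_sum_covers (m : nat) (K : {set 'I_m}) (b : bits m) : K != set0 ->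
  2 * phase_sum K b = - (-1) ^+ #|K| *
   \sum_(JJ : {set {set 'I_m}} | (JJ \subset coef b) && (cover JJ == K)) (-2) ^+ #|JJ|.
Proof.
move=> K0.
have reidx (F : qubit m -> int) : \sum_(x in std_subgroup K) F x =
    \sum_(X : {set 'I_m} | X \subset K) F (indicator_vec X).
  rewrite (reindex (@indicator_vec m)); last first.
    by exists (@supp m) => x _; [exact: indicator_vecK|exact: suppK].
  by apply: eq_bigl => X; rewrite mem_std_subgroup indicator_vecK.
(* As [K] is nonempty the signs cancel, so the constant term of [1 - 2 b(x) = (-1)^b(x)] drops
   out. *)
have Z : \sum_(x in std_subgroup K) ((-1) ^+ hamming_weight x : int)%R = 0.
  have := sum_subsets_sign int set0 K; rewrite eq_sym (negbTE K0) mulr0n.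
  rewrite reidx; apply: etrans; apply: eq_big => X; rewrite ?sub0set // => _.
  by rewrite /hamming_weight -/(supp _) indicator_vecK.
have -> : 2 * phase_sum K b =
    - \sum_(x in std_subgroup K) (-1) ^+ hamming_weight x * (-1) ^+ b x.
  rewrite -sub0r -[X in X - _]Z -sumrB mulr_sumr; apply: eq_bigr => x _.
  rewrite mulrCA -[X in X - _]mulr1 -mulrBr; congr (_ * _).
  by case: (b x) => [[|[|?]] ?].
rewrite reidx mulNr; congr (- _).
under eq_bigr => X _.
  rewrite /hamming_weight -/(supp _) sign_bits_coef indicator_vecK mulr_sumr.
  over.
rewrite (exchange_big_dep (fun JJ : {set {set 'I_m}} => JJ \subset coef b)) /=; last first.
  by move=> X JJ _ /andP[].
rewrite mulr_sumr [RHS]big_mkcondr; apply: eq_bigr => JJ JJb.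
rewrite -mulr_suml.
under eq_bigl => X do rewrite JJb /= andbC.
rewrite sum_subsets_sign; case: eqP => _; by rewrite ?mulr1n ?mulr0n ?mul0r.
Qed.

Lemma phase_sum_mod (m r k : nat) (K : {set 'I_m}) (b : bits m) :
  (forall J : {set 'I_m}, (r < #|J|)%N -> coef b J = false) ->
  (k * r < #|K|)%N ->
  exists2 z : int, phase_sum K b = 2 ^+ k * z &
    odd `|z| = odd #|[set JJ : {set {set 'I_m}} |
       [&& JJ \subset coef b, cover JJ == K & #|JJ| == k.+1]]|.
Proof.
move=> Hb kK.
have cover_card (JJ : {set {set 'I_m}}) : JJ \subset coef b -> cover JJ == K -> (k < #|JJ|)%N.
  move=> /subsetP JJb /eqP cJJ; rewrite ltnNge; apply: contraTN kK => JJk.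
  rewrite -leqNgt -cJJ; apply: leq_trans (leq_card_cover JJ).1 _.
  apply: (@leq_trans (\sum_(J in JJ) r)%N); last by rewrite sum_nat_const leq_mul2r JJk orbT.
  by apply: leq_sum => J /JJb cJ; rewrite leqNgt; apply/negP => /Hb;
    rewrite -[coef b J]/(J \in coef b) cJ.
set N := #|_|.
(* The covers with more than [k.+1] members, with [(-2) ^+ k.+2] factored out; by [cover_card] the
   truncated subtraction in the exponent is exact. *)
pose T : int := \sum_(JJ : {set {set 'I_m}} |
  ((JJ \subset coef b) && (cover JJ == K)) && (#|JJ| != k.+1)) (-2) ^+ (#|JJ| - k.+2).
(* The sign comes from [- (-1) ^+ #|K| * (-2) ^+ k.+1], which is [2 * 2 ^+ k] times
   [(-1) ^+ (#|K| + k)]. *)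
exists ((-1) ^+ (#|K| + k) * (N%:Z + (-2) * T)).
  apply: (@mulfI _ (2 : int)) => //; rewrite phase_sum_covers; last first.
    by rewrite -card_gt0; apply: leq_ltn_trans kK.
  rewrite (bigID (fun JJ : {set {set 'I_m}} => #|JJ| == k.+1)) /=.
  have -> : \sum_(JJ : {set {set 'I_m}} |
      ((JJ \subset coef b) && (cover JJ == K)) && (#|JJ| == k.+1))
      (-2) ^+ #|JJ| = ((-2) ^+ k.+1 * N%:Z)%R.
    rewrite (eq_bigr (fun=> (-2) ^+ k.+1)) => [|JJ /andP[_ /eqP-> //]].
    rewrite big_const iter_addr_0 -[N%:Z]natz mulr_natr; congr (_ *+ _); apply: eq_card => JJ.
    by rewrite !inE andbA.
  have -> : \sum_(JJ : {set {set 'I_m}} |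
      ((JJ \subset coef b) && (cover JJ == K)) && (#|JJ| != k.+1))
      (-2) ^+ #|JJ| = ((-2) ^+ k.+2 * T)%R.
    rewrite mulr_sumr; apply: eq_bigr => JJ /andP[/andP[h1 h2] h3].
    rewrite -exprD subnKC // ltn_neqAle eq_sym h3; exact: cover_card.
  rewrite !exprS exprD -[-2]mulN1r !exprMn; ring.
rewrite abszM abszX oddM oddX orbT /=; lia.
Qed.

(** * Complex phases and the diagonal action of the transversal operator *)

Lemma expiD (R : realType) (s t : R) : expi (s + t) = expi s * expi t.
Proof.
by apply/eqP; rewrite eq_complex /= cosD sinD; apply/andP; split; apply/eqP; ring.
Qed.

Lemma expi0 (R : realType) : expi (0 : R) = 1.
Proof. by rewrite /expi cos0 sin0. Qed.

Lemma expiN (R : realType) (t : R) : expi (- t) = (expi t)^*.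
Proof. by rewrite /expi cosN sinN. Qed.

Lemma expi_sum (R : realType) (I : finType) (P : pred I) (F : I -> R) :
  expi (\sum_(i | P i) F i) = \prod_(i | P i) expi (F i).
Proof. exact: (big_morph _ (@expiD R) (@expi0 R)). Qed.

Lemma expi_pi_int (R : realType) (z : int) :
  expi (pi * z%:~R : R) = (-1) ^+ odd `|z|.
Proof.
have pin (n : nat) : expi (pi * n%:R : R) = (-1) ^+ odd n.
  rewrite signr_odd; elim: n => [|n IH]; first by rewrite mulr0 expi0.
  rewrite -natr1 mulrDr mulr1 expiD IH exprSr; congr (_ * _).
  by rewrite /expi cospi sinpi; apply/eqP; rewrite eq_complex /= oppr0 !eqxx.
case: (intP z) => [|n|n]; rewrite ?abszN -?[_%:~R]/(_%:R) ?pin //.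
by rewrite mulrNz mulrN expiN -[_%:~R]/(_%:R) pin rmorphXn rmorphN1.
Qed.

Lemma Zk_alternatingE (R : realType) (m k : nat) (K : {set 'I_m}) (psi : state R m) b :
  Zk_alternating k (std_subgroup K) psi b =
  expi (pi / 2 ^+ k * (phase_sum K b)%:~R) * psi b.
Proof.
rewrite /Zk_alternating.
(* The angle contributed by qubit [x]: conjugating the gate at odd weight negates it, and a bit 0
   contributes nothing. *)
pose t x := pi / 2 ^+ k * ((-1) ^+ hamming_weight x * (b x)%:R) : R.
rewrite (@tensor_op1 _ _ _ (fun x => if x \in std_subgroup K then expi (t x) else 1) id).
  rewrite -big_mkcond -expi_sum /phase_sum -mulr_sumr rmorph_sum /=.
  congr (expi (_ * _) * _); apply: eq_bigr => x _.
  by rewrite rmorphM rmorphXn rmorphN1.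
move=> x j; rewrite /t; case: (x \in _); last first.
  by rewrite mxE [j == _]eq_sym; case: (b x == j).
rewrite -[in RHS]signr_odd; case: (odd _); rewrite !mxE.
  rewrite (eq_sym j); case: (eqVneq (b x) j) => [<-|_]; last by rewrite mulr0n rmorph0.
  rewrite mulr1n; case: (b x) => [[|[|?]] ?] //=.
    by rewrite !mulr0 expi0 rmorph1.
  by rewrite expr1 mulr1 mulrN1 expiN.
rewrite (eq_sym j); case: (eqVneq (b x) j) => [_|_]; last by rewrite mulr0n.
rewrite mulr1n; case: (b x) => [[|[|?]] ?] //=.
  by rewrite !mulr0 expi0.
by rewrite expr0 !mulr1.
Qed.

(** * Covers by arbitrary monomials against covers by logical qubits *)

Lemma card_min_covers (m q r k : nat) (K : {set 'I_m}) (c : pred {set 'I_m}) :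
  (forall J : {set 'I_m}, (r < #|J|)%N -> c J = false) ->
  (q + k * r < #|K|)%N ->
  #|[set JJ in min_covers q r k K
      | (JJ != set0) && [forall J in JJ, c (val J)]]| =
  #|[set JJ : {set {set 'I_m}}
      | [&& JJ \subset c, cover JJ == K & #|JJ| == k.+1]]|.
Proof.
move=> Hc qkK; have val_im_inj := imset_inj (@val_inj _ _ (logical_qubit m q r)).
rewrite -(card_imset _ val_im_inj); apply: eq_card => LL.
rewrite [RHS]inE; apply/imsetP/and3P => [[JJ]|[/subsetP LLc /eqP cLL /eqP kLL]].
  rewrite !inE => /andP[/andP[/eqP cJJ /eqP kJJ]] /andP[_ /forall_inP HJ] ->.
  rewrite cover_imset cJJ card_imset ?kJJ; last exact: val_inj.
  by split=> //; apply/subsetP => _ /imsetP[J /HJ cJ ->].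
have cLr L : L \in LL -> (#|L| <= r)%N.
  by move=> /LLc cL; rewrite leqNgt; apply/negP => /Hc; rewrite -[c L]/(L \in c) cL.
(* A member of size at most [q] is impossible: the other [k] members cover at most [k * r] elements,
   and [K] has more than [q + k * r]. *)
have cL L : L \in LL -> (q < #|L| <= r)%N.
  move=> LLL; rewrite cLr // andbT -(ltn_add2r (k * r)); apply: leq_trans qkK _.
  rewrite -cLL; apply: leq_trans (leq_card_cover LL).1 _.
  rewrite (big_setD1 L) //= leq_add2l.
  have -> : k = #|LL :\ L| by apply: succn_inj; rewrite -kLL (cardsD1 L LL)
      (LLL : (L \in LL) = true).
  rewrite -sum_nat_const; apply: leq_sum => A /setD1P[_]; exact: cLr.
pose JJ : {set logical_qubit m q r} := [set J | val J \in LL].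
have JJE : LL = val @: JJ.
  apply/setP => L; apply/idP/imsetP => [LLL|[J + ->]]; last by rewrite inE.
  by exists (exist _ L (cL L LLL)); rewrite ?inE.
have kJJ : #|JJ| = k.+1 by rewrite -kLL JJE card_imset //; exact: val_inj.
exists JJ => //; rewrite !inE -cover_imset -JJE cLL kJJ !eqxx /=.
rewrite -card_gt0 kJJ /=; apply/forall_inP => J; rewrite inE; exact: LLc.
Qed.
End ReedMullerPhases.

Theorem theorem7p10 (R : realType) (m q r k : nat) (hqr : (q < r)%N)
    (hrm : (r <= m)%N) (v0 : state R m) (hv0 : is_logical_zero q r v0)
    (K : {set 'I_m}) (hK : K \in cover_index m q r k) :
  logically_equiv q r
    (Zk_alternating k (std_subgroup K))
    (logical_CZs v0 (min_covers q r k K)).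
Proof.
(* The two operators agree exactly on the code, with no global phase. *)
exists 0%R => psi Hpsi; rewrite expi0 scale1r.
move: hK; rewrite inE => /andP[hK _].
rewrite (code_expansion hv0 hqr Hpsi) logical_CZs_sum //.
apply/ffunP => b; rewrite Zk_alternatingE !sum_ffunE mulr_sumr.
apply: eq_bigr => a _; rewrite !ffunE -!/(_ * _)%R.
have [z|nz] := eqVneq (logical_basis v0 a b) 0%R.
  by rewrite z !scaler0 mulr0.
have Hb (J : {set 'I_m}) : (r < #|J|)%N -> coef b J = false.
  by move=> rJ; apply: logical_basis_coef_gt nz rJ (ltn_trans hqr rJ).
have kK : (k * r < #|K|)%N by apply: leq_trans hK; rewrite addn1 ltnS leq_addl.
have [z -> zN] := phase_sum_mod Hb kK.
have ab (J : logical_qubit m q r) : coef b (val J) = a J.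
  exact: logical_basis_coef nz.
rewrite /GRing.scale /= mulrA; congr (_ * _)%R; congr (_ * _)%R.
(* The power of 2 dividing the phase sum cancels the denominator of the angle, leaving a sign. *)
have -> : (pi / 2 ^+ k * (2 ^+ k * z)%:~R = pi * z%:~R :> R)%R.
  by rewrite rmorphM rmorphXn /= mulrA divfK // expf_neq0 // pnatr_eq0.
rewrite expi_pi_int zN -[RHS]signr_odd; congr (_ ^+ nat_of_bool (odd _))%R.
rewrite -(@card_min_covers m q r k K (coef b)) //; last by rewrite -addn1.
apply: eq_card => JJ; rewrite !inE; congr [&& _, _ & _].
by apply: eq_forallb => J; rewrite ab.
Qed.
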